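(* Let $k$ be a positive integer. Assume that for some integer $h$ with $2 \le h \le k$ the following holds: for every $\eta > 0$ there exists a positive integer $n_{0}(\eta)$ such that for every $n \ge n_{0}(\eta)$, $R_{(\mathbb{Z}^{+})^{k},h}(n) < n^{\eta}$. Then for every $\varepsilon > 0$ there exists a set $A \subseteq (\mathbb{Z}^{+})^{k}$ such that $R_{A,h}(n)$ is bounded (as a function of the positive integer $n$) and \[ A(x) \gg x^{\frac{1}{k}-\varepsilon} = x^{\min\{\frac{1}{k},\frac{1}{h}\}-\varepsilon}. \]
   Context: Here $(\mathbb{Z}^{+})^{k} = \{1^{k}, 2^{k}, 3^{k}, \dots\}$ denotes the set of positive perfect $k$-th powers. For a set $A$ of positive integers and an integer $h \ge 2$, $R_{A,h}(n)$ denotes the number of solutions of $a_{1} + a_{2} + \dots + a_{h} = n$ with $a_{1}, \dots, a_{h} \in A$ and $a_{1} < a_{2} < \dots < a_{h}$. The counting function is $A(x) = |\{a \in A : a \le x\}|$. The notation $f(x) \ll g(x)$ means $f(x) = O(g(x))$ as $x \to \infty$, and $f \gg g$ means $g \ll f$; the implied constant may depend on $k, h, \varepsilon$ and $A$. *)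

(* Defs.v *)
From mathcomp Require Import all_boot all_order all_algebra finmap.
From mathcomp Require Import all_classical all_reals all_analysis.
Import Order.TTheory GRing.Theory Num.Theory.
Import numFieldNormedType.Exports.
Local Open Scope classical_set_scope.

Definition pos_powers (k : nat) : set nat :=
  [set (m ^ k)%N | m in [set m : nat | (0 < m)%N]].

Definition representations (A : set nat) (h n : nat) : set (h.-tuple nat) :=
  [set a | [/\ forall i : 'I_h, A (tnth a i),
               forall i j : 'I_h, (i < j)%N -> (tnth a i < tnth a j)%N
             & (\sum_(i < h) tnth a i)%N = n]].

Lemma finite_representations (A : set nat) (h n : nat) :
  finite_set (representations A h n).
Proof.
pose f (t : h.-tuple 'I_n.+1) : h.-tuple nat := [tuple of map val t].
apply: (@sub_finite_set _ _ (f @` [set: h.-tuple 'I_n.+1])); last first.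
  by apply: finite_image; exact: finite_finset.
move=> a [_ _ sa]; exists [tuple inord (tnth a i) | i < h] => //.
apply: eq_from_tnth => i; rewrite tnth_map tnth_mktuple /= inordK// ltnS -sa.
by rewrite (bigD1 i)//= leq_addr.
Qed.

(* [fset_set] sends infinite sets to the empty one; the sets counted here and
   in [counting_fun] are finite. *)
Definition repr_count (A : set nat) (h n : nat) : nat :=
  #|` fset_set (representations A h n)|.

Definition below {R : realType} (A : set nat) (x : R) : set nat :=
  [set a | A a /\ (a%:R <= x)%R].

Lemma finite_below {R : realType} (A : set nat) (x : R) :
  finite_set (below A x).
Proof.
apply: (@sub_finite_set _ _ `I_(Num.truncn x).+1); last exact: finite_II.
move=> a [_ ax] /=; rewrite ltnS truncn_ge_nat//.
by rewrite (le_trans _ ax).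
Qed.

Definition counting_fun {R : realType} (A : set nat) (x : R) : nat :=
  #|` fset_set (below A x)|.

(* Lets the Landau notations be used along [+oo] in the reals. *)
Canonical pinfty_filter_on (R : numFieldType) : filter_on R :=
  FilterType (pinfty_nbhs R) _.

(* Main.v *)
(* Cut the [k]-th powers into blocks [2^(rkj), 2^(rk(j+1))), where [1/r <= eps],
   and keep a fraction [2^-j] of block [j]. For [l <= h] and every [n], few
   elements of block [j] are the largest part of a representation of [n] with
   [l] parts: at most [2^(j/2)] for large [j], by the hypothesis on [h] (padding
   with large powers turns [l] parts into [h] parts). Only [2^O(j)] pairs [(l, n)]
   matter, so for [T] large a count of colorings gives a coloring of block [j]
   with [2^j] colors in which no color is used [T] times among the largest
   parts of representations of one [n]; keep the largest color class. Since [h] is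
   at most the ratio of consecutive blocks, the largest part of a representation
   of [n] lies in one of two blocks, so there are at most [2T] choices for it, and
   induction on [l] bounds the number of representations by [(2T)^l]. *)
Require Import Defs.
From mathcomp Require Import all_boot all_order all_algebra finmap zify ring.
From mathcomp Require Import all_classical all_reals all_analysis.
Set Implicit Arguments.
Unset Strict Implicit.
Unset Printing Implicit Defensive.
Import Order.TTheory GRing.Theory Num.Theory.
Import numFieldNormedType.Exports.

(** * Sparse subsets from a count of colorings *)

Lemma bin_leq_exp n m : 'C(n, m) <= n ^ m.
Proof.
have le_ffact : n ^_ m <= n ^ m.
  by elim: m => // m IH; rewrite ffactnSr expnSr leq_mul// leq_subr.
by rewrite (leq_trans _ le_ffact)// -bin_ffact leq_pmulr// fact_gt0.
Qed.

(** The colors on [X] are forced and the others are free. The product form avoids the exponent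
    [#|V| - #|X|]. *)
Lemma card_constant_colorings (V : finType) (q : nat) (X : {set V}) (a : 'I_q) :
  #|[set c : {ffun V -> 'I_q} | [forall v in X, c v == a]]| * q ^ #|X|
    = q ^ #|V|.
Proof.
pose F (v : V) : pred 'I_q := if v \in X then pred1 a else predT.
have -> : #|[set c : {ffun V -> 'I_q} | [forall v in X, c v == a]]|
    = #|(family F : {pred {ffun V -> 'I_q}})|.
  apply: eq_card => c; rewrite inE; apply/forall_inP/familyP => cX v.
    by rewrite /F; case: ifP => // /cX.
  by move=> vX; have := cX v; rewrite /F vX.
have -> : #|(family F : {pred {ffun V -> 'I_q}})| = \prod_(v : V) #|F v|.
  by rewrite card_family foldrE big_image.
rewrite (bigID (mem X))/= big1 => [|v vX]; last by rewrite /F vX card1.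
under eq_bigr => v /negPf vX do rewrite /F vX card_ord.
rewrite mul1n prod_nat_const -expnD; congr (_ ^ _).
by rewrite addnC -(cardC (mem X)).
Qed.

(** Union bound: a coloring fails only if some [T]-subset of some [U i] is monochromatic. There are
    at most [#|I| * K * q] choices of index, subset and color, and each excludes a fraction [q ^ -T]
    of all colorings. *)
Lemma exists_coloring (V I : finType) (U : I -> {set V}) (q T K : nat) :
    (0 < q)%N -> (forall i, #|U i| ^ T <= K) -> #|I| * K * q < q ^ T ->
  exists c : V -> 'I_q, forall i a, #|[set v in U i | c v == a]| < T.
Proof.
move=> q_gt0 UK few.
pose bad (X : {set V}) (a : 'I_q) :=
  [set c : {ffun V -> 'I_q} | [forall v in X, c v == a]].
pose Ts i := [set X : {set V} | X \subset U i & #|X| == T].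
suff [c /forallP cP] : exists c : {ffun V -> 'I_q},
    [forall i, [forall a, #|[set v in U i | c v == a]| < T]].
  by exists c => i a; move: (cP i) => /forallP.
apply/existsP; apply: contraT => /existsPn all_bad.
have : q ^ #|V| * q ^ T <=
    (\sum_i \sum_(X in Ts i) \sum_a #|bad X a|) * q ^ T.
  rewrite leq_mul2r; apply/orP; right.
  have -> : q ^ #|V| = \sum_(c : {ffun V -> 'I_q}) 1.
    by rewrite sum1_card card_ffun card_ord.
  have -> : \sum_i \sum_(X in Ts i) \sum_a #|bad X a| =
    \sum_(c : {ffun V -> 'I_q}) \sum_i \sum_(X in Ts i) \sum_a (c \in bad X a : nat).
    rewrite [RHS]exchange_big/=; apply: eq_bigr => i _.
    rewrite [RHS]exchange_big/=; apply: eq_bigr => X _.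
    rewrite [RHS]exchange_big/=; apply: eq_bigr => a _.
    by rewrite -sum1_card big_mkcond; apply: eq_bigr => c _; case: (c \in _).
  apply: leq_sum => c _; have := all_bad c.
  (* A color class too large on [U i] contains a list of exactly [T] points, so this coloring is
     counted at least once. *)
  case/forallPn => i /forallPn[a]; rewrite -leqNgt => /card_geqP[s [us sT sU]].
  have cX : #|[set v in s]| = T by rewrite cardsE (card_uniqP us).
  rewrite (bigD1 i)//= (bigD1 [set v in s])/=; last first.
    rewrite inE cX eqxx andbT; apply/fintype.subsetP => v; rewrite inE => /sU.
    by rewrite inE => /andP[].
  have cb : c \in bad [set v in s] a.
    by rewrite inE; apply/forall_inP => v; rewrite inE => /sU; rewrite inE => /andP[].
  by rewrite (bigD1 a)//= cb -!addnA leq_addr.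
rewrite leqNgt => /negP[]; rewrite !big_distrl/=.
apply: (@leq_ltn_trans (\sum_(i : I) K * q * q ^ #|V|)); last first.
  by rewrite sum_nat_const !mulnA mulnC ltn_pmul2l ?expn_gt0 ?q_gt0.
apply: leq_sum => i _; rewrite big_distrl/=.
apply: (@leq_trans (\sum_(X in Ts i) q * q ^ #|V|)).
  apply: leq_sum => X; rewrite inE => /andP[_ /eqP XT].
  rewrite big_distrl/= -XT; under eq_bigr do rewrite card_constant_colorings.
  by rewrite sum_nat_const card_ord.
rewrite sum_nat_const cards_draws -mulnA leq_mul2r.
by rewrite (leq_trans (bin_leq_exp _ _) (UK i)) orbT.
Qed.

(** Pigeonhole: the largest color class inside [B] has at least [#|B| / q] elements, and it inherits
    the sparsity of its color. *)
Lemma exists_sparse_subset (V I : finType) (B : {set V}) (U : I -> {set V})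
    (q T K : nat) :
    (0 < q)%N -> (forall i, #|U i| ^ T <= K) -> #|I| * K * q < q ^ T ->
  exists S : {set V}, [/\ S \subset B, #|B| <= q * #|S|
    & forall i, #|U i :&: S| < T].
Proof.
move=> q_gt0 UK /(exists_coloring q_gt0 UK)[c cP].
have [|a amax] := bigop.eq_bigmax (fun a => #|[set v in B | c v == a]|).
  by rewrite card_ord.
exists [set v in B | c v == a]; split.
- by apply/fintype.subsetP => v; rewrite inE => /andP[].
- have -> : q * #|[set v in B | c v == a]|
      = \sum_(b < q) #|[set v in B | c v == a]|.
    by rewrite sum_nat_const card_ord.
  rewrite -amax -sum1_card.
  rewrite (partition_big c predT)//=; apply: leq_sum => b _.
  rewrite (leq_trans _ (bigop.leq_bigmax b))// -sum1_card.
  by apply/eq_leq/eq_bigl => v; rewrite inE.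
- move=> i; apply: leq_ltn_trans (cP i a); apply: subset_leq_card.
  by apply/fintype.subsetP => v; rewrite !inE => /andP[-> /andP[_ ->]].
Qed.

(** * Recursive count of representations *)

Local Open Scope classical_set_scope.


(* Increasing [l]-tuples in [A] of sum [n] with entries below [N], by largest entry. *)
Fixpoint nreps (A : set nat) (l N n : nat) : nat :=
  if l is l'.+1 then
    \sum_(m < n.+1 | (m < N) && ((m : nat) \in A)) nreps A l' m (n - m)
  else n == 0.

(** Following the recursion of [nreps] with lists ties that count to the cardinality
    [repr_count]. *)
Fixpoint rep_seqs (A : set nat) (l N n : nat) : seq (seq nat) :=
  if l is l'.+1 then
    [seq rcons s (m : nat)
    | m : 'I_n.+1 <- enum [pred m : 'I_n.+1 | (m < N) && (val m \in A)],
      s <- rep_seqs A l' m (n - m)]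
  else if n == 0 then [:: [::]] else [::].

Lemma size_rep_seqs A l N n : size (rep_seqs A l N n) = nreps A l N n.
Proof.
elim: l N n => [|l IH] N n /=; first by case: eqP.
rewrite size_allpairs_dep sumnE big_map big_enum/=.
by apply: eq_bigr => m _; rewrite IH.
Qed.

Lemma rep_seqs_uniq A l N n : uniq (rep_seqs A l N n).
Proof.
elim: l N n => [|l IH] N n /=; first by case: eqP.
apply: allpairs_uniq_dep => [|//|]; first exact: enum_uniq.
move=> [m s] [m' s'] _ _ /= /eqP; rewrite eqseq_rcons => /andP[/eqP -> /eqP /val_inj].
by move->.
Qed.

Lemma mem_rep_seqs A l N n s :
  (s \in rep_seqs A l N n) =
  [&& size s == l, pairwise ltn s, all (fun m => (m < N) && (m \in A)) s
    & sumn s == n].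
Proof.
elim: l N n s => [|l IH] N n s /=.
  case: s => [|x s]; first by rewrite /= [0 == n]eq_sym; case: eqP.
  by case: eqP.
case/lastP: s => [|s x].
  by apply/negbTE/negP => /allpairsPdep[m [[|y s] [_ _]]].
rewrite size_rcons eqSS pairwise_rcons all_rcons sumn_rcons.
apply/allpairsPdep/and4P => [[m [s' [+ +]]]|].
  rewrite mem_enum inE IH => /andP[mN mA] /and4P[ss os as' /eqP ns] /eqP.
  rewrite eqseq_rcons => /andP[/eqP -> /eqP ->]; split => //.
  - by rewrite os andbT; apply: sub_all as' => y /andP[].
  - rewrite mN mA/=; apply: sub_all as' => y /andP[ym ->].
    by rewrite (ltn_trans ym mN).
  - by rewrite ns subnK// -ltnS.
move=> [ss /andP[ax os] /andP[/andP[xN xA] aNA] /eqP ns].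
have xn : x < n.+1 by rewrite ltnS -ns leq_addl.
exists (Ordinal xn), s; split => //; first by rewrite mem_enum inE /= xN.
rewrite IH ss os/= -ns addnK eqxx andbT.
apply/allP => y ys; have /andP[_ ->] := allP aNA _ ys.
by rewrite andbT; exact: (allP ax).
Qed.

Lemma repr_countE A h n : repr_count A h n = nreps A h n.+1 n.
Proof.
rewrite -size_rep_seqs -(undup_id (rep_seqs_uniq A h n.+1 n)) -card_fseq.
rewrite /repr_count; set F := fset_set _.
have -> : #|` F| = #|` [fset val a | a in F]%fset|.
  by rewrite card_imfset//; exact: val_inj.
congr (#|` _|); apply/fsetP => s; rewrite !inE mem_rep_seqs.
have sumE (a : h.-tuple nat) : sumn a = (\sum_(i < h) tnth a i)%N.
  by rewrite sumnE big_tuple.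
apply/imfsetP/and4P => [[a + ->]|[/eqP sh os /allP aA /eqP ns]].
  rewrite /= in_fset_set ?inE; last exact: finite_representations.
  move=> [aA oa na]; rewrite size_tuple sumE na; split => //.
  - apply/(pairwiseP 0) => i j; rewrite !inE size_tuple => ih jh ij.
    by have := oa (Ordinal ih) (Ordinal jh) ij; rewrite !(tnth_nth 0).
  - apply/allP => x /tnthP[i ->]; rewrite mem_set ?andbT; last exact: aA.
    by rewrite ltnS -na (bigD1 i)//= leq_addr.
have sh' : size s == h by apply/eqP.
exists (Tuple sh') => //=; rewrite in_fset_set; last exact: finite_representations.
rewrite inE; split=> [i|i j ij|]; last by rewrite -sumE.
  by have /andP[_] := aA _ (mem_tnth i (Tuple sh')); rewrite inE.
rewrite !(tnth_nth 0)/=; apply: (pairwiseP 0 os) => //.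
all: by rewrite inE sh.
Qed.

Lemma leq_nreps A Z l N N' n :
  A `<=` Z -> N <= N' -> nreps A l N n <= nreps Z l N' n.
Proof.
move=> AZ; elim: l N N' n => //= l IH N N' n NN'.
rewrite big_mkcond [leqRHS]big_mkcond; apply: leq_sum => m _.
case: ifPn => // /andP[mN /set_mem mA].
by rewrite (leq_trans mN NN') mem_set ?IH//; exact: AZ.
Qed.

Lemma nreps_bound A l N n : nreps A l N n <= nreps A l n.+1 n.
Proof.
case: l => //= l; rewrite big_mkcond [leqRHS]big_mkcond; apply: leq_sum => m _.
by rewrite ltn_ord; case: (m < N).
Qed.

Lemma nreps_gt0_le A l N n : 0 < nreps A l N n -> n <= l * N.
Proof.
elim: l N n => [|l IH] N n /=; first by case: n.
rewrite lt0n sum_nat_eq0 => /forallPn[m]; rewrite negb_imply -lt0n.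
move=> /andP[/andP[mN _] /IH]; rewrite leq_subLR => /leq_trans; apply.
by rewrite mulSn leq_add ?leq_mul// ltnW.
Qed.

(** The power [n.+1 ^ k] exceeds [n], hence every part of a representation of [n], so it can be
    appended as a new largest part. *)
Lemma nreps_pad Z k l N n : 0 < k -> pos_powers k `<=` Z ->
  nreps Z l N n <= nreps Z l.+1 (n + n.+1 ^ k).+1 (n + n.+1 ^ k).
Proof.
move=> k0 kZ; rewrite (leq_trans (nreps_bound _ _ _ _))//=.
have MZ : n.+1 ^ k \in Z by rewrite inE; apply: kZ; exists n.+1.
have lM : n.+1 ^ k < (n + n.+1 ^ k).+1 by rewrite ltnS leq_addl.
rewrite (bigD1 (Ordinal lM))/= ?lM ?MZ// addnK.
rewrite (leq_trans _ (leq_addr _ _))// leq_nreps//.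
by rewrite -[leqLHS]expn1 leq_pexp2l.
Qed.

(** A bound [C * n.+1] on every fixed power [s] expresses growth slower than any power of [n],
    without real exponents. Padding enlarges [n] to about its [k]-th power, so dropping one part
    turns exponent [s * k] into [s]. *)
Lemma nreps_few Z k h : 0 < k -> pos_powers k `<=` Z ->
    (forall s, exists C, forall n N, nreps Z h N n ^ s <= C * n.+1) ->
  forall s, exists C, forall l n N, l <= h -> nreps Z l N n ^ s <= C * n.+1.
Proof.
move=> k0 kZ few s.
have {}few d s' : exists C, forall n N, nreps Z (h - d) N n ^ s' <= C * n.+1.
  elim: d s' => [|d IH] s'; first by rewrite subn0.
  have [lt_dh|le_hd] := ltnP d h; last first.
    by have := IH s'; rewrite (eqP le_hd) subnS (eqP le_hd).
  (* The factor 2 comes from [n + n.+1 ^ k + 1 <= 2 * n.+1 ^ k]. *)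
  have [C CP] := IH (s' * k); exists (2 * C.+1) => n N.
  have := CP (n + n.+1 ^ k) (n + n.+1 ^ k).+1.
  rewrite -(subnSK lt_dh) => {}CP.
  rewrite -(leq_exp2r _ _ k0) -expnM.
  apply: (leq_trans (leq_trans _ CP)).
    by case: (s' * k) => // e; rewrite leq_exp2r// nreps_pad.
  rewrite expnMn.
  have le_nM : n.+1 <= n.+1 ^ k by rewrite -[leqLHS]expn1 leq_pexp2l.
  have le_C : 2 * C.+1 <= (2 * C.+1) ^ k by rewrite -[leqLHS]expn1 leq_pexp2l.
  nia.
have [C CP] := choice (few^~ s).
exists (\sum_(d < h.+1) C d) => l n N lh; have := CP (h - l) n N.
rewrite subKn// => /leq_trans; apply.
have hl : h - l < h.+1 by rewrite ltnS leq_subr.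
by rewrite leq_mul2r (bigD1 (Ordinal hl))//= leq_addr.
Qed.

(** * Choosing one sparse block *)

(** Each [v] in [U] gives a representation of [n] with largest part [f v], and distinct largest
    parts give distinct representations. *)
Lemma card_top_leq Z l n (V : finType) (f : V -> nat) (U : {set V}) :
    injective f ->
    (forall v, v \in U -> [/\ f v \in Z, f v <= n & 0 < nreps Z l (f v) (n - f v)]) ->
  #|U| <= nreps Z l.+1 n.+1 n.
Proof.
move=> f_inj UP /=.
have -> : #|U| = #|[set (inord (f v) : 'I_n.+1) | v in U]%SET|.
  rewrite card_in_imset// => u v /UP[_ un _] /UP[_ vn _].
  by move=> /(congr1 val); rewrite /= !inordK// => /f_inj.
rewrite -sum1_card big_mkcond [leqRHS]big_mkcond; apply: leq_sum => m _.
case: ifPn => // /imsetP[v /UP[vZ vn v_gt0] ->].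
by rewrite ltn_ord inordK//= vZ.
Qed.

Lemma exists_blocks Z k r h : 0 < k -> 0 < r -> pos_powers k `<=` Z ->
    (forall s, exists C, forall l n N, l <= h -> nreps Z l N n ^ s <= C * n.+1) ->
  exists T j0, forall j, j0 <= j -> exists S : seq nat,
    [/\ uniq S,
        forall v, v \in S -> v \in Z /\ 2 ^ (r * k * j) <= v < 2 ^ (r * k * j.+1),
        2 ^ (r * j) <= 2 ^ j * size S
      & forall l n, l < h ->
          count (fun v => (v <= n) && (0 < nreps Z l v (n - v))) S < T].
Proof.
move=> k0 r0 kZ few; set w := r * k.
(* Every relevant [n] is below [2 ^ (D * j)], so the power [2 * D.+1] yields [#|U i| ^ 2 <= 2 ^ j]
   once [C <= 2 ^ j]. *)
pose D := h + 2 * w; have [C CP] := few (2 * D.+1).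
(* With [T = 2 * t] and [q = 2 ^ j], sets [U i] give [K = 2 ^ (j * t)], the square root of [q ^ T];
   [t] is large enough for the other root to absorb [#|I| * q]. *)
pose t := 2 * h + 2 * w + 2.
exists (2 * t), C.+1 => j Cj.
have h2 : h < 2 ^ h by exact: ltn_expl.
pose V := 'I_(2 ^ (w * j.+1)).
pose B := [set v : V | ((v : nat) \in Z) && (2 ^ (w * j) <= v)]%SET.
pose top l n v := (v <= n) && (0 < nreps Z l v (n - v)).
pose U (i : 'I_h * 'I_(h * 2 ^ (w * j.+1))) :=
  [set v in B | top i.1 i.2 (v : nat)]%SET.
have j0 : 0 < j by lia.
have U2 i : #|U i| ^ 2 <= 2 ^ j.
  have le_UC : #|U i| ^ (2 * D.+1) <= C * (i.2).+1.
    apply: leq_trans (CP i.1.+1 i.2 i.2.+1 (ltn_ord _)).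
    rewrite leq_exp2r//; apply: (@card_top_leq _ _ _ V val) => [|v].
      exact: val_inj.
    by rewrite !finset.in_set => /andP[/andP[-> _] /andP[-> ->]].
  rewrite -(@leq_exp2r _ _ D.+1)// -!expnM (leq_trans le_UC)//.
  have nD : (i.2).+1 <= 2 ^ (D * j).
    rewrite (leq_trans (ltn_ord i.2))//.
    rewrite (leq_trans (leq_mul (ltnW h2) (leqnn _)))//.
    rewrite -expnD leq_exp2l// /D; nia.
  rewrite [leqRHS](_ : _ = 2 ^ j * 2 ^ (D * j)); last first.
    by rewrite -expnD mulnS [D * j]mulnC.
  by rewrite leq_mul// (leq_trans _ (ltnW (ltn_expl j _)))// ltnW.
have [|||S [SB cS ST]] := @exists_sparse_subset _ _ B U (2 ^ j) (2 * t) (2 ^ (j * t)).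
- by rewrite expn_gt0.
- by move=> i; rewrite expnM [leqRHS]expnM leq_exp2r ?U2// /t; lia.
- rewrite card_prod !card_ord -!expnM.
  apply: (@leq_ltn_trans (2 ^ h * (2 ^ h * 2 ^ (w * j.+1)) * 2 ^ (j * t) * 2 ^ j)).
    by rewrite !leq_mul// ltnW.
  by rewrite -!expnD ltn_exp2l// /t; nia.
(* The [k]-th powers of the integers from [2 ^ (r * j)] up to twice that value lie in the block,
   since [r] is positive. *)
have cB : 2 ^ (r * j) <= #|B|.
  have fP (i : 'I_(2 ^ (r * j))) : (2 ^ (r * j) + i) ^ k < 2 ^ (w * j.+1).
    have -> : w * j.+1 = (r * j.+1) * k by rewrite /w; ring.
    rewrite [ltnRHS]expnM ltn_exp2r// mulnS expnD.
    have := ltn_ord i; have : 2 ^ 1 <= 2 ^ r by rewrite leq_exp2l.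
    nia.
  rewrite -[leqLHS]card_ord -(@card_imset _ _ (fun i => Ordinal (fP i) : V)).
    apply: subset_leq_card; apply/fintype.subsetP => _ /imsetP[i _ ->].
    rewrite finset.in_set/=; apply/andP; split.
      rewrite inE; apply: kZ; exists (2 ^ (r * j) + i) => //=.
      by rewrite addn_gt0 expn_gt0.
    have -> : w * j = (r * j) * k by rewrite /w; ring.
    by rewrite [leqLHS]expnM leq_exp2r// leq_addr.
  move=> i i' /(congr1 val)/= /eqP; rewrite eqn_exp2r// eqn_add2l => /eqP.
  exact: val_inj.
exists [seq val v | v <- enum S]; split.
- by rewrite map_inj_uniq ?enum_uniq//; exact: val_inj.
- move=> _ /mapP[v + ->]; rewrite mem_enum => /(fintype.subsetP SB).
  by rewrite finset.in_set => /andP[vZ ->]; rewrite ltn_ord.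
- by rewrite size_map -cardE (leq_trans cB).
- move=> l n lh; rewrite count_map.
  have [nM|Mn] := ltnP n (h * 2 ^ (w * j.+1)).
    apply: leq_ltn_trans (ST (Ordinal lh, Ordinal nM)).
    rewrite -size_filter -(card_uniqP (filter_uniq _ (enum_uniq _))).
    apply: subset_leq_card; apply/fintype.subsetP => v.
    rewrite mem_filter mem_enum => /andP[vP vS].
    rewrite finset.in_setI vS finset.in_set (fintype.subsetP SB)// andbT; exact: vP.
  (* At most [h] parts, all below [2 ^ (w * j.+1)], cannot add up to such a large [n]. *)
  rewrite (_ : count _ _ = 0); first by rewrite /t; lia.
  apply/eqP; rewrite -leqn0 leqNgt -has_count; apply/hasPn => v _ /=.
  apply/negP => /andP[vn /nreps_gt0_le]; rewrite leq_subLR -mulSn.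
  have := ltn_ord v; nia.
Qed.

(** * Union of the sparse blocks *)

(** Largest parts are tested against representations in all of [Z], so the condition on one block
    does not depend on the choice of the others. *)
Lemma sparse_union_nreps Z w h T (S : nat -> seq nat) : h <= 2 ^ w -> 0 < w ->
    (forall j v, v \in S j -> v \in Z /\ 2 ^ (w * j) <= v < 2 ^ (w * j.+1)) ->
    (forall j l n, l < h ->
       count (fun v => (v <= n) && (0 < nreps Z l v (n - v))) (S j) <= T) ->
  forall l N n, l <= h ->
    nreps [set v | exists j, v \in S j] l N n <= (2 * T) ^ l.
Proof.
move=> hw w0 SP ST; set A := [set v | exists j, v \in S j].
have AZ : A `<=` Z by move=> v [j /SP[/set_mem]].
elim=> [|l IH] N n lh /=; first by case: eqP.
pose top v := (v <= n) && (0 < nreps Z l v (n - v)).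
pose P := [set m : 'I_n.+1 | ((m : nat) \in A) && top m]%SET.
apply: (@leq_trans (\sum_(m in P) (2 * T) ^ l)).
  rewrite big_mkcond [leqRHS]big_mkcond; apply: leq_sum => m _.
  case: ifPn => // /andP[mN mA].
  rewrite finset.in_set mA /top -[m <= n]ltnS ltn_ord/=.
  have [Z0|_] := posnP; last by rewrite IH// ltnW.
  by rewrite -Z0 leq_nreps.
rewrite sum_nat_const expnS leq_mul2r; apply/orP; right.
(* A top summand lies between [n / h] and [n], hence in one of two blocks. *)
pose j := trunc_log (2 ^ w) n.
have w1 : 1 < 2 ^ w by rewrite -[1]/(2 ^ 0) ltn_exp2l.
(* For [j = 0] both blocks are [S 0], which only doubles the bound. *)
apply: (@leq_trans (size [seq v <- S j.-1 ++ S j | top v])); last first.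
  by rewrite size_filter count_cat mul2n -addnn leq_add// ST.
rewrite cardE -(size_map val); apply: uniq_leq_size.
  by rewrite map_inj_uniq ?enum_uniq//; exact: val_inj.
move=> _ /mapP[m + ->]; rewrite mem_enum finset.in_set => /andP[/set_mem[i mi] mtop].
rewrite mem_filter mtop mem_cat /=.
have /andP[mn /nreps_gt0_le] := mtop; rewrite leq_subLR -mulSn => nm.
have [_] := SP _ _ mi; rewrite !expnM => /andP[im mi1].
have m0 : 0 < m by rewrite (leq_trans _ im)// expn_gt0 expn_gt0.
have n0 : 0 < n by rewrite (leq_trans m0).
have ij : i <= j by apply: trunc_log_max => //; exact: leq_trans mn.
have ji : j < i.+2.
  rewrite -(ltn_exp2l _ _ w1) (leq_ltn_trans (trunc_logP w1 n0))//.
  rewrite (leq_ltn_trans nm)// [_ ^ i.+2]expnS.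
  apply: (leq_ltn_trans (leq_mul (leq_trans lh hw) (leqnn _))).
  by rewrite ltn_pmul2l// ltnW.
have [ij'|ij'] := eqVneq i j; first by rewrite -ij' mi orbT.
by rewrite (_ : j.-1 = i) ?mi//; lia.
Qed.

(** * Real exponents and growth of the counting function *)

Local Open Scope ring_scope.

Lemma nreps_pow_leq (R : realType) (Z : set nat) h :
    (forall eta : R, 0 < eta ->
       exists n0 : nat, (0 < n0)%N /\
         forall n : nat, (n0 <= n)%N ->
           (repr_count Z h n)%:R < (n%:R : R) `^ eta) ->
  forall s, exists C, forall n N, (nreps Z h N n ^ s <= C * n.+1)%N.
Proof.
(* The exponent [1 / s.+1] also makes sense for [s = 0]. The finitely many [n < n0] are absorbed
   into [C]. *)
move=> few s; have [|n0 [_ n0P]] := few s.+1%:R^-1; first by rewrite invr_gt0.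
pose c n := (nreps Z h n.+1 n ^ s)%N.
exists (\sum_(n < n0) c n).+1 => n N.
have nc : (nreps Z h N n ^ s <= c n)%N.
  by rewrite /c; case: (s) => // t; rewrite leq_exp2r// nreps_bound.
rewrite (leq_trans nc)//; have [nn0|/n0P] := ltnP n n0.
  rewrite (leq_trans _ (leq_pmulr _ _))// ltnW// ltnS.
  by rewrite (bigD1 (Ordinal nn0))//= leq_addr.
rewrite repr_countE => nlt.
have {}nlt : (nreps Z h n.+1 n ^ s.+1 < n)%N.
  rewrite -(ltr_nat R) natrX.
  rewrite (_ : n%:R = (n%:R `^ s.+1%:R^-1) ^+ s.+1 :> R).
    by rewrite ltr_pXn2r// nnegrE// powR_ge0.
  by rewrite -powR_mulrn ?powR_ge0// -powRrM mulVf// powRr1.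
rewrite (@leq_trans n.+1) ?leq_pmull// /c.
have [->|p] := posnP (nreps Z h n.+1 n); first by case: (s) => // t; rewrite exp0n.
by rewrite (leq_trans _ (leq_trans (ltnW nlt) _))// leq_pexp2l.
Qed.

Lemma leq_counting_fun (R : realType) (A : set nat) (x : R) (s : seq nat) :
  uniq s -> (forall v, v \in s -> A v /\ v%:R <= x) ->
  (size s <= counting_fun A x)%N.
Proof.
move=> us sA; rewrite /counting_fun -(undup_id us) -card_fseq.
apply: fsubset_leq_card; apply/fsubsetP => v; rewrite inE => /sA vP.
by rewrite in_fset_set ?inE//; exact: finite_below.
Qed.

(** If [x] lies in the range of block [i.+1], the whole block [i] lies below [x] and has at least
    [2 ^ (r * i)] elements, while [x < 2 ^ (w * i.+2)]. The two extra steps in the exponent cost the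
    factor [2 ^ (2 * r)]. *)
Lemma block_union_growth (R : realType) (r k j0 : nat) (S : nat -> seq nat) :
    (0 < k)%N ->
    (forall j, uniq (S j)) ->
    (forall j v, v \in S j -> (v < 2 ^ (r.+1 * k * j.+1))%N) ->
    (forall j, (j0 <= j)%N -> (2 ^ (r.+1 * j) <= 2 ^ j * size (S j))%N) ->
  forall x : R, (2 ^ (r.+1 * k * j0.+1))%:R <= x ->
    x `^ (r%:R / (r.+1 * k)%:R) <=
      (2 ^ (2 * r))%:R * (counting_fun [set v | exists j, v \in S j] x)%:R.
Proof.
move=> k0 uS Sb Ssize x; set w := (r.+1 * k)%N => xw.
have w0 : (0 < w)%N by rewrite muln_gt0.
have w1 : (1 < 2 ^ w)%N by rewrite -[1%N]/(2 ^ 0)%N ltn_exp2l.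
have x0 : 0 <= x by rewrite (le_trans _ xw).
pose n := Num.truncn x; pose j := trunc_log (2 ^ w) n.
have n_ge : (2 ^ (w * j0.+1) <= n)%N by rewrite truncn_ge_nat.
have n0 : (0 < n)%N by rewrite (leq_trans _ n_ge)// expn_gt0.
have j0j : (j0.+1 <= j)%N by apply: trunc_log_max; rewrite -?expnM.
have x_lt : x < (2 ^ (w * j.+1))%:R.
  rewrite (lt_le_trans (truncnS_gt x))// ler_nat expnM.
  exact: trunc_log_ltn.
have jx : (2 ^ (w * j))%:R <= x.
  rewrite -truncn_ge_nat// expnM; exact: trunc_logP.
case E : j j0j x_lt jx => [//|i] j0i x_lt jx.
have sx : (size (S i) <= counting_fun [set v | exists j, v \in S j] x)%N.
  apply: leq_counting_fun => // v vS; split; first by exists i.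
  by rewrite (le_trans _ jx)// ler_nat ltnW// Sb.
have ri : (2 ^ (r * i) <= size (S i))%N.
  have := Ssize i j0i.
  by rewrite mulSn expnD leq_pmul2l// expn_gt0.
have -> : (2 ^ (2 * r))%:R *
    (counting_fun [set v | exists j, v \in S j] x)%:R =
    (2 ^ (2 * r) * counting_fun [set v | exists j, v \in S j] x)%:R :> R.
  by rewrite natrM.
apply: (@le_trans _ _ (2 ^ (r * i.+2))%:R); last first.
  by rewrite ler_nat !mulnS addnA expnD mul2n -addnn leq_mul// (leq_trans ri).
rewrite (_ : (2 ^ (r * i.+2))%:R =
    ((2 ^ (w * i.+2))%:R : R) `^ (r%:R / w%:R)); last first.
  rewrite !natrX -!powR_mulrn// -powRrM; congr (_ `^ _).
  by rewrite !natrM; field; rewrite nat1r !pnatr_eq0 -lt0n k0.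
have p0 : 0 <= r%:R / w%:R :> R by rewrite divr_ge0.
by rewrite (ge0_ler_powR p0) ?nnegrE ?x0 ?ler0n ?(ltW x_lt).
Qed.
Theorem theorem2 (R : realType) (k h : nat) (k_gt0 : (0 < k)%N)
    (h_ge2 : (2 <= h)%N) (h_le_k : (h <= k)%N)
    (few_reprs : forall eta : R, 0 < eta ->
       exists n0 : nat, (0 < n0)%N /\
         forall n : nat, (n0 <= n)%N ->
           (repr_count (pos_powers k) h n)%:R < (n%:R : R) `^ eta) :
  forall eps : R, 0 < eps ->
    exists A : set nat,
      [/\ A `<=` pos_powers k,
          exists C : nat, forall n : nat, (0 < n)%N ->
            (repr_count A h n <= C)%N,
          (fun x : R => x `^ (k%:R^-1 - eps) : R^o)
            =O_+oo (fun x : R => (counting_fun A x)%:R : R^o)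
        & forall x : R, 0 < x ->
            x `^ (k%:R^-1 - eps)
              = x `^ (Num.min (k%:R^-1) (h%:R^-1) - eps)].
Proof.
move=> eps eps0.
(* The first summand gives [1 / w <= eps], the second [h <= 2 ^ w]. *)
pose r := (Num.truncn eps^-1 + h)%N.
pose w := (r.+1 * k)%N.
have eps_w : w%:R^-1 <= eps :> R.
  rewrite -[leRHS]invrK lef_pV2 ?posrE ?invr_gt0// ?ltr0n ?muln_gt0//.
  rewrite (le_trans (ltW (truncnS_gt _)))// ler_nat /w /r.
  by rewrite (leq_trans _ (leq_pmulr _ _))// ltnS leq_addr.
have hw : (h <= 2 ^ w)%N.
  rewrite (leq_trans _ (ltnW (ltn_expl w _)))//.
  by rewrite (leq_trans _ (leq_pmulr _ _))// /r; lia.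
have kk := @subset_refl _ (pos_powers k).
have few := nreps_few k_gt0 kk (nreps_pow_leq few_reprs).
have [T [j0 blocks]] := exists_blocks k_gt0 (ltn0Sn r) kk few.
pose good j S := [/\ uniq S,
  forall v, v \in S ->
    v \in pos_powers k /\ (2 ^ (w * j) <= v < 2 ^ (w * j.+1))%N,
  (j0 <= j)%N -> (2 ^ (r.+1 * j) <= 2 ^ j * size S)%N
  & forall l n, (l < h)%N -> (count (fun v => (v <= n)%N &&
      (0 < nreps (pos_powers k) l v (n - v))%N) S <= T)%N].
have /choice[S goodS] : forall j, exists S, good j S.
  move=> j; have [jj0|/blocks[S [uS SZ sS cS]]] := ltnP j j0.
    (* Blocks before [j0] are left empty. *)
    by exists [::]; split => //; rewrite leqNgt jj0.
  by exists S; split => // l n /cS-/(_ n)/ltnW.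
exists [set v | exists j, v \in S j]; split.
- by move=> v [j vS]; have [_ /(_ _ vS)[/set_mem]] := goodS j.
- exists ((2 * T) ^ h)%N => n _; rewrite repr_countE.
  apply: (sparse_union_nreps hw) => // [|j v|j l m].
  + by rewrite muln_gt0.
  + by have [_ + _ _] := goodS j; exact.
  + by have [_ _ _] := goodS j; exact.
- apply/eqO_exP; exists (2 ^ (2 * r))%:R; first by rewrite ltr0n expn_gt0.
  exists (2 ^ (w * j0.+1))%:R; split; first exact: num_real.
  move=> x /ltW xw; rewrite !ger0_norm ?powR_ge0//.
  have x1 : 1 <= x by rewrite (le_trans _ xw)// ler1n expn_gt0.
  apply: le_trans (block_union_growth k_gt0 _ _ _ xw); last first.
  + by move=> j; have [_ _] := goodS j.
  + by move=> j v; have [_ + _ _] := goodS j => /[apply] -[_ /andP[]].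
  + by move=> j; have [] := goodS j.
  (* The exponent obtained from the blocks is [r / w = 1 / k - 1 / w], at least [1 / k - eps]. *)
  rewrite ler_powR// (@le_trans _ _ (k%:R^-1 - w%:R^-1))//.
    by rewrite lerB.
  rewrite le_eqVlt; apply/orP; left; apply/eqP; rewrite natrM; field.
  by rewrite nat1r !pnatr_eq0 -lt0n k_gt0.
- by move=> x _; rewrite min_l// lef_pV2 ?posrE ?ltr0n ?ler_nat// ltnW.
Qed.
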